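(* Let $f:\mathbb{R}^n\to\mathbb{R}$ and $c:\mathbb{R}^n\to\mathbb{R}^m$ ($m\le n$) be differentiable, let $f_{\mathrm{low}}\in\mathbb{R}$ satisfy $f(x)\ge f_{\mathrm{low}}$ for all $x\in\mathbb{R}^n$, and let $\varepsilon_0,\varepsilon_1>0$, $\alpha>1$, $\beta_0\ge 1$. Let $x_0\in\mathbb{R}^n$ satisfy $\|c(x_0)\|\le \varepsilon_0/\sqrt{2}$, and let $x_1,x_2,\dots$ be iterates generated from $x_0$ by the Quadratic Penalty Method (QPM) with penalty parameters $\beta_k=\alpha^k\beta_0$ and feasibility-aware tolerance $\tau$. Define $$T(\varepsilon_0):=\inf\{k\in\mathbb{N},\ k\ge 1:\ \|c(x_k)\|\le\varepsilon_0\}.$$ Then $$T(\varepsilon_0)<\hat T(\varepsilon_0):=2+\log_\alpha\!\left(4(f(x_0)-f_{\mathrm{low}})\,\beta_0^{-1}\varepsilon_0^{-2}\right),$$ and the point $x_{T(\varepsilon_0)}$ generated by QPM is an $(\varepsilon_0,\varepsilon_1)$-approximate KKT point, satisfying $$\|c(x_{T(\varepsilon_0)})\|\le\varepsilon_0\quad\text{and}\quad \Big\|\nabla f(x_{T(\varepsilon_0)})+\beta_{T(\varepsilon_0)-1}\sum_{i=1}^m c_i(x_{T(\varepsilon_0)})\nabla c_i(x_{T(\varepsilon_0)})\Big\|\le\varepsilon_1 .$$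
   Context: $\|\cdot\|$ is the Euclidean norm. The problem is: minimize $f(x)$ subject to $c(x)=0$. A point $x$ is an $(\varepsilon_0,\varepsilon_1)$-approximate KKT point if there is $\lambda\in\mathbb{R}^m$ with $\|c(x)\|\le\varepsilon_0$ and $\|\nabla f(x)-\sum_{i=1}^m\lambda_i\nabla c_i(x)\|\le\varepsilon_1$. Quadratic penalty: $Q_\beta(x)=f(x)+\frac{\beta}{2}\|c(x)\|^2$. Feasibility-aware tolerance: for some $\tau_{\mathrm{cap}}\ge\varepsilon_1$, $\tau(x)=\max\{\varepsilon_1,\min(\tau_{\mathrm{cap}},\frac{\varepsilon_1}{\varepsilon_0}\|c(x)\|)\}$. QPM: given $\varepsilon_0,\varepsilon_1>0$, $\alpha>1$, $\beta_0\ge1$, $\tau$ and $x_0$; for $k=0,1,2,\dots$: find $x_{k+1}$ such that $Q_{\beta_k}(x_{k+1})\le\min\{Q_{\beta_k}(x_k),Q_{\beta_k}(x_0)\}$ and $\|\nabla Q_{\beta_k}(x_{k+1})\|\le\tau(x_{k+1})$ (such points are assumed to be found at every iteration); if $\|c(x_{k+1})\|\le\varepsilon_0$, stop and return $x_{k+1}$; otherwise set $\beta_{k+1}=\alpha\beta_k$ and continue.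
   Formalization: The bound T < 2+log_α(A), A = 4(f(x0)-f_low)/(β0 ε0²), is proved when A > 1/α; when A ≤ 1/α it fails or is undefined (e.g. f=0, c=0, f_low slightly below 0 gives T=1), and T = 1 is proved instead. All other conclusions are unconditional. *)

(* Defs.v *)
From HB Require Import structures.
From mathcomp Require Import all_boot all_order all_algebra.
From mathcomp Require Import all_classical all_reals all_analysis.

Set Implicit Arguments.
Unset Strict Implicit.
Unset Printing Implicit Defensive.

Import Order.TTheory GRing.Theory Num.Theory.
Import numFieldNormedType.Exports.

Local Open Scope classical_set_scope.
Local Open Scope ring_scope.

(* The library norm `|x| on 'rV[R]_n is the sup norm, so the Euclidean norm is
   defined here.  The library's differentiability on 'rV[R]_n is unaffected by
   this choice, all norms on 'rV[R]_n being equivalent. *)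
Definition norm2 (R : realType) (n : nat) (x : 'rV[R]_n) : R :=
  Num.sqrt (\sum_(i < n) x 0 i ^+ 2).

Definition grad (R : realType) (n : nat) (f : 'rV[R]_n -> R) (x : 'rV[R]_n) :
    'rV[R]_n :=
  \row_(i < n) 'D_(delta_mx 0 i) f x.

Definition component (R : realType) (n m : nat) (c : 'rV[R]_n -> 'rV[R]_m)
    (i : 'I_m) : 'rV[R]_n -> R :=
  fun x => c x 0 i.

Definition approx_KKT (R : realType) (n m : nat) (f : 'rV[R]_n -> R)
    (c : 'rV[R]_n -> 'rV[R]_m) (eps0 eps1 : R) (x : 'rV[R]_n) : Prop :=
  exists lambda : 'rV[R]_m,
    norm2 (c x) <= eps0 /\
    norm2 (grad f x - \sum_(i < m) lambda 0 i *: grad (component c i) x)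
      <= eps1.

Definition quad_penalty (R : realType) (n m : nat) (f : 'rV[R]_n -> R)
    (c : 'rV[R]_n -> 'rV[R]_m) (beta : R) : 'rV[R]_n -> R :=
  fun x => f x + beta / 2 * norm2 (c x) ^+ 2.

Definition feas_aware_tol (R : realType) (n m : nat)
    (c : 'rV[R]_n -> 'rV[R]_m) (eps0 eps1 tau_cap : R) (x : 'rV[R]_n) : R :=
  Num.max eps1 (Num.min tau_cap (eps1 / eps0 * norm2 (c x))).

Definition penalty_param (R : realType) (alpha beta0 : R) (k : nat) : R :=
  alpha ^+ k * beta0.

Definition QPM_step (R : realType) (n m : nat) (f : 'rV[R]_n -> R)
    (c : 'rV[R]_n -> 'rV[R]_m) (tau : 'rV[R]_n -> R) (beta : R)
    (x0 xk xk1 : 'rV[R]_n) : Prop :=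
  quad_penalty f c beta xk1
    <= Num.min (quad_penalty f c beta xk) (quad_penalty f c beta x0) /\
  norm2 (grad (quad_penalty f c beta) xk1) <= tau xk1.

(* The method stops at the first k >= 1 with ||c(x_k)|| <= eps0, so iteration k
   takes place only if none of x_1, ..., x_k passed the test; the terms of the
   sequence after the returned point are unconstrained.  The stopping test is
   not applied to x_0. *)
Definition QPM_iterates (R : realType) (n m : nat) (f : 'rV[R]_n -> R)
    (c : 'rV[R]_n -> 'rV[R]_m) (eps0 alpha beta0 : R) (tau : 'rV[R]_n -> R)
    (x0 : 'rV[R]_n) (x : nat -> 'rV[R]_n) : Prop :=
  x 0%N = x0 /\
  forall k : nat,
    (forall j : nat, (1 <= j <= k)%N -> ~ (norm2 (c (x j)) <= eps0)) ->
    QPM_step f c tau (penalty_param alpha beta0 k) x0 (x k) (x k.+1).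

(* Valued in \bar R, so that the infimum of the empty set is +oo. *)
Definition stopping_time (R : realType) (n m : nat)
    (c : 'rV[R]_n -> 'rV[R]_m) (eps0 : R) (x : nat -> 'rV[R]_n) : \bar R :=
  ereal_inf [set (k%:R)%:E | k in
    [set k : nat | (1 <= k)%N /\ norm2 (c (x k)) <= eps0]].

(* As ln is 0 on nonpositive reals, log is meaningful only for a > 0. *)
Definition log (R : realType) (b a : R) : R := ln a / ln b.

Definition log_arg (R : realType) (n : nat) (f : 'rV[R]_n -> R)
    (f_low eps0 beta0 : R) (x0 : 'rV[R]_n) : R :=
  4 * (f x0 - f_low) * beta0^-1 * eps0 ^- 2.

Definition That (R : realType) (n : nat) (f : 'rV[R]_n -> R)
    (f_low eps0 alpha beta0 : R) (x0 : 'rV[R]_n) : R :=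
  2 + log alpha (log_arg f f_low eps0 beta0 x0).

(* Main.v *)
Require Import Defs.
From mathcomp Require Import all_boot all_order all_algebra.
From mathcomp Require Import all_classical all_reals all_analysis.
From mathcomp Require Import ring lra.
Import Order.TTheory GRing.Theory Num.Theory.
Import numFieldNormedType.Exports.
Local Open Scope classical_set_scope.
Local Open Scope ring_scope.

(* Suppose that iteration k is carried out and x_{k+1} fails the stopping test.
   Then Q(x_{k+1}) <= Q(x_0) for the penalty beta_k, together with
   ||c(x_{k+1})|| > eps0 and ||c(x_0)||^2 <= eps0^2 / 2, gives
   beta_k * eps0^2 / 4 < f(x_0) - f_low, that is, alpha^k < log_arg.  So the
   method stops, and applying this to the iterate before the returned one bounds
   T - 2 by the logarithm of log_arg.  At the returned point the tolerance is
   eps1, and the gradient of the penalty function is the gradient of the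
   Lagrangian with multipliers -beta_k c_i. *)

Lemma norm2_ge0 (R : realType) (n : nat) (x : 'rV[R]_n) : 0 <= norm2 x.
Proof. exact: sqrtr_ge0. Qed.

Lemma sqr_norm2 (R : realType) (n : nat) (x : 'rV[R]_n) :
  norm2 x ^+ 2 = \sum_(i < n) x 0 i ^+ 2.
Proof. by rewrite sqr_sqrtr// sumr_ge0// => i _; exact: sqr_ge0. Qed.

Lemma differentiable_component (R : realType) (n m : nat)
    (c : 'rV[R]_n -> 'rV[R]_m) (i : 'I_m) (x : 'rV[R]_n) :
  differentiable c x -> differentiable (component c i) x.
Proof.
move=> dc.
exact: (@differentiable_comp _ _ _ _ c (fun y : 'rV[R]_m => y 0 i)
          x dc (differentiable_coord _ _ _)).
Qed.

Lemma grad_quad_penalty (R : realType) (n m : nat) (f : 'rV[R]_n -> R)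
    (c : 'rV[R]_n -> 'rV[R]_m) (beta : R) (x : 'rV[R]_n) :
  differentiable f x -> differentiable c x ->
  grad (quad_penalty f c beta) x =
  grad f x + beta *: \sum_(i < m) c x 0 i *: grad (component c i) x.
Proof.
move=> df dc; apply/rowP => j; rewrite !mxE summxE.
set v := delta_mx 0 j.
(* With the squared norm expanded into squares of components, the penalty is built from sums,
   scalings and powers of functions, which derivative inference can handle. *)
have -> : quad_penalty f c beta =
    f + (beta / 2) \*: \sum_(i < m) (component c i) ^+ 2.
  apply/funext => y; rewrite /quad_penalty sqr_norm2 /=.
  by congr (_ + _ * _); rewrite fct_sumE; apply: eq_bigr.
have dfv : is_derive x v f ('D_v f x) by exact/derivableP/diff_derivable.
have dcv i : is_derive x v (component c i) ('D_v (component c i) x).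
  exact/derivableP/diff_derivable/differentiable_component.
rewrite derive_val; congr (_ + _).
rewrite /GRing.scale/= -mulrA; congr (_ * _).
rewrite mulr_sumr; apply: eq_bigr => i _.
by rewrite !mxE /component -/v expr1 /GRing.scale /=; field.
Qed.

(** The ratio [norm2 (c x) / eps0] is at most 1, so the inner minimum cannot exceed [eps1], whatever
    the cap. *)
Lemma feas_aware_tol_feasible (R : realType) (n m : nat)
    (c : 'rV[R]_n -> 'rV[R]_m) (eps0 eps1 tau_cap : R) (x : 'rV[R]_n) :
  0 < eps0 -> 0 < eps1 -> norm2 (c x) <= eps0 ->
  feas_aware_tol c eps0 eps1 tau_cap x = eps1.
Proof.
move=> e0 e1 cx; apply/max_idPl; rewrite ge_min; apply/orP; right.
by rewrite -mulrA ler_piMr ?(ltW e1)// ler_pdivrMl ?mulr1.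
Qed.

Lemma penalty_lt_of_infeasible (R : realType) (n m : nat) (f : 'rV[R]_n -> R)
    (c : 'rV[R]_n -> 'rV[R]_m) (f_low eps0 beta : R) (x0 y : 'rV[R]_n) :
  0 < eps0 -> 0 < beta -> f_low <= f y ->
  norm2 (c x0) <= eps0 / Num.sqrt 2 ->
  quad_penalty f c beta y <= quad_penalty f c beta x0 ->
  eps0 < norm2 (c y) -> beta < 4 * (f x0 - f_low) * eps0 ^- 2.
Proof.
move=> e0 b0 fy cx0 Q cy.
have e20 : 0 < eps0 ^+ 2 by rewrite exprn_gt0.
have c0 : norm2 (c x0) ^+ 2 <= eps0 ^+ 2 / 2.
  rewrite -[X in _ / X]sqr_sqrtr ?ler0n// -expr_div_n.
  by rewrite lerXn2r// nnegrE ?norm2_ge0// divr_ge0 ?sqrtr_ge0// ltW.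
have c1 : eps0 ^+ 2 < norm2 (c y) ^+ 2.
  by rewrite ltrXn2r// ?nnegrE ?norm2_ge0// ltW.
rewrite ltr_pdivlMr//.
move: Q; rewrite /quad_penalty => Q.
(* Once both bounds are multiplied by [beta], the goal is linear in the products that occur. *)
have := ler_wpM2l (ltW b0) c0; have := c1; rewrite -(ltr_pM2l b0); lra.
Qed.

Lemma lt_log_of_expr_lt (R : realType) (alpha a : R) (k : nat) :
  1 < alpha -> alpha ^+ k < a -> k%:R < log alpha a.
Proof.
move=> a1 ka; have a0 : 0 < alpha by exact: lt_trans a1.
have ak : 0 < alpha ^+ k by rewrite exprn_gt0.
rewrite /log ltr_pdivlMr ?ln_gt0// mulr_natl -lnXn// ltr_ln ?posrE//.
exact: lt_trans ka.
Qed.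

Lemma log_mull (R : realType) (alpha a : R) :
  1 < alpha -> 0 < a -> log alpha (alpha * a) = 1 + log alpha a.
Proof.
move=> a1 a0; have alpha0 : 0 < alpha by exact: lt_trans a1.
by rewrite /log lnM ?posrE// mulrDl divff// gt_eqF// ln_gt0.
Qed.

Lemma stopping_timeE (R : realType) (n m : nat) (c : 'rV[R]_n -> 'rV[R]_m)
    (eps0 : R) (x : nat -> 'rV[R]_n) (T : nat) :
  (1 <= T)%N -> norm2 (c (x T)) <= eps0 ->
  (forall j, (1 <= j < T)%N -> eps0 < norm2 (c (x j))) ->
  stopping_time c eps0 x = (T%:R)%:E.
Proof.
move=> T1 cT Tmin; apply/eqP; rewrite eq_le; apply/andP; split.
  by apply: ereal_inf_lbound; exists T.
apply: le_ereal_inf_tmp => _ [k [k1 ck] <-].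
rewrite lee_fin ler_nat leqNgt; apply/negP => kT.
by have := Tmin k; rewrite k1 kT ltNge ck => /(_ isT).
Qed.

Lemma QPM_infeasible_expr_lt (R : realType) (n m : nat) (f : 'rV[R]_n -> R)
    (c : 'rV[R]_n -> 'rV[R]_m) (f_low eps0 alpha beta0 : R)
    (tau : 'rV[R]_n -> R) (x0 : 'rV[R]_n) (x : nat -> 'rV[R]_n) (k : nat) :
  (forall y, f_low <= f y) -> 0 < eps0 -> 0 < alpha -> 0 < beta0 ->
  norm2 (c x0) <= eps0 / Num.sqrt 2 ->
  QPM_iterates f c eps0 alpha beta0 tau x0 x ->
  (forall j, (1 <= j <= k.+1)%N -> eps0 < norm2 (c (x j))) ->
  alpha ^+ k < log_arg f f_low eps0 beta0 x0.
Proof.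
move=> hlow e0 a0 b0 cx0 [_ step] inf.
have [|Q _] := step k.
  move=> j /andP[j1 jk]; apply/negP; rewrite -ltNge.
  by rewrite inf// j1 leqW.
move: Q; rewrite le_min => /andP[_ Q].
have bk : 0 < penalty_param alpha beta0 k by rewrite mulr_gt0// exprn_gt0.
have := @penalty_lt_of_infeasible _ _ _ _ _ f_low _ _ _ _ e0 bk (hlow _) cx0 Q
  (inf _ _).
rewrite ltnS leqnn => /(_ isT).
by rewrite /penalty_param -ltr_pdivlMr// /log_arg mulrAC.
Qed.

(* The bound T < That cannot hold when That <= 1, since T >= 1; this happens
   when log_arg <= 1 / alpha (for instance f constant, c = 0 and f_low just
   below f), and for f x0 = f_low the logarithm is not even defined.  The bound
   is therefore stated for 1 / alpha < log_arg, which says exactly That > 1; in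
   the remaining case T = 1.  The other conclusions are unconditional. *)
Theorem theorem3p2 (R : realType) (n m : nat) (hmn : (m <= n)%N)
  (f : 'rV[R]_n -> R) (c : 'rV[R]_n -> 'rV[R]_m)
  (hf : forall x : 'rV[R]_n, differentiable f x)
  (hc : forall x : 'rV[R]_n, differentiable c x)
  (f_low : R) (hlow : forall x, f_low <= f x)
  (eps0 eps1 alpha beta0 tau_cap : R)
  (heps0 : 0 < eps0) (heps1 : 0 < eps1) (halpha : 1 < alpha)
  (hbeta0 : 1 <= beta0) (hcap : eps1 <= tau_cap)
  (x0 : 'rV[R]_n) (hx0 : norm2 (c x0) <= eps0 / Num.sqrt 2)
  (x : nat -> 'rV[R]_n)
  (hx : QPM_iterates f c eps0 alpha beta0
          (feas_aware_tol c eps0 eps1 tau_cap) x0 x) :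
  exists T : nat,
    [/\ stopping_time c eps0 x = (T%:R)%:E,
        (alpha^-1 < log_arg f f_low eps0 beta0 x0 ->
           T%:R < That f f_low eps0 alpha beta0 x0) /\
        (log_arg f f_low eps0 beta0 x0 <= alpha^-1 -> T = 1%N),
        approx_KKT f c eps0 eps1 (x T),
        norm2 (c (x T)) <= eps0
      & norm2 (grad f (x T)
               + penalty_param alpha beta0 (T - 1) *:
                 \sum_(i < m) c (x T) 0 i *: grad (component c i) (x T))
          <= eps1].
Proof.
have alpha0 : 0 < alpha by exact: lt_trans halpha.
have beta00 : 0 < beta0 by exact: lt_le_trans hbeta0.
set A := log_arg f f_low eps0 beta0 x0.
have expr_lt k : (forall j, (1 <= j <= k.+1)%N -> eps0 < norm2 (c (x j))) ->
    alpha ^+ k < A.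
  exact: QPM_infeasible_expr_lt hlow heps0 alpha0 beta00 hx0 hx.
have exT : exists k, (1 <= k)%N && (norm2 (c (x k)) <= eps0).
  (* If no iterate passed the test, [alpha ^+ k < A] would hold for every [k], hence
     [k < log alpha A], against the Archimedean property. *)
  apply: contrapT => noT.
  have /(lt_log_of_expr_lt _ _ _ _ halpha) :
      alpha ^+ Num.bound `|log alpha A| < A.
    apply: expr_lt => j /andP[j1 _]; rewrite ltNge; apply/negP => cj.
    by apply: noT; exists j; rewrite j1.
  by rewrite ltNge (le_trans (ler_norm _))// ltW// archi_boundP.
case: (ex_minnP exT) => T /andP[T1 cT] Tmin.
have infeasible j : (1 <= j < T)%N -> eps0 < norm2 (c (x j)).
  move=> /andP[j1 jT]; rewrite ltNge; apply/negP => cj.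
  by have := Tmin j; rewrite j1 cj leqNgt jT => /(_ isT).
have TexprA k : T = k.+2 -> alpha ^+ k < A.
  by move=> Tk; apply: expr_lt => j jk; apply: infeasible; rewrite Tk ltnS.
have gradT : norm2 (grad f (x T) + penalty_param alpha beta0 (T - 1) *:
    \sum_(i < m) c (x T) 0 i *: grad (component c i) (x T)) <= eps1.
  rewrite -grad_quad_penalty//.
  (* Turns [eps1] back into the tolerance at [x T], so that the goal is the gradient test of
     iteration [T - 1]. *)
  rewrite -(feas_aware_tol_feasible _ _ _ _ _ _ tau_cap _ heps0 heps1 cT).
  have [_ /(_ (T - 1)%N)] := hx; rewrite -subSn// subSS subn0.
  case=> // j /andP[j1 jT]; apply/negP; rewrite -ltNge infeasible// j1/=.
  by rewrite (leq_ltn_trans jT)// subn1 prednK.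
exists T; split => //; first exact: stopping_timeE.
- split=> hA.
    have A0 : 0 < A by apply: lt_trans hA; rewrite invr_gt0.
    (* For [T = 1] this is [hA] itself; for larger [T] it is [TexprA] at [T - 2], multiplied by
       [alpha]. Taking logarithms gives [T - 1 < 1 + log alpha A]. *)
    have lt_alphaA : alpha ^+ (T - 1) < alpha * A.
      case: T T1 TexprA {cT Tmin infeasible gradT} => [|[|k]]// _ TexprA.
        by rewrite expr0 mulrC -ltr_pdivrMr// mul1r.
      by rewrite subn1/= exprS ltr_pM2l// TexprA.
    have := lt_log_of_expr_lt _ _ _ _ halpha lt_alphaA.
    by rewrite log_mull// /That -/A natrB//; lra.
  apply/eqP; rewrite eqn_leq T1 andbT leqNgt; apply/negP => T2.
  (* Here [T >= 2], so [1 <= alpha ^+ (T - 2) < A], while [A <= alpha^-1 <= 1]. *)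
  have : 1 < A.
    apply: le_lt_trans (TexprA (T - 2)%N _); first by rewrite exprn_ege1// ltW.
    by rewrite -add2n subnKC.
  by rewrite ltNge (le_trans hA)// invf_le1// ltW.
- exists (- penalty_param alpha beta0 (T - 1) *: c (x T)); split=> //.
  under eq_bigr do rewrite mxE mulNr scaleNr -scalerA.
  by rewrite sumrN opprK -scaler_sumr.
Qed.
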